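(* Let $S>8$ be an integer that is not a power of $2$, and let $N$ be the integer with $2^{N-2}<S<2^{N-1}$; put $g=2^{N-2}$. Suppose that $S$ has exactly one high-bit, which is then its leading bit $g$, and let $s=S \bmod g$. Then, in the emanation table of the $2^N$-ions with strut constant $S$ (the inner skybox), a cell with row label $R$ and column label $C$ not on a long diagonal (that is, with $P=R\oplus C\notin\{0,S\}$) is filled if and only if at least one of $R$, $C$, $P$ equals $g$ or $s$. More generally, for every $n\ge N$, in the emanation table of the $2^n$-ions with the same strut constant $S$, a cell with row label $R$ and column label $C$ not on a long diagonal is filled if and only if at least one of $R$, $C$, $P=R\oplus C$ belongs to the set consisting of the integer multiples $k\cdot g$ of the inner-skybox $g$ that are less than $2^{n-1}$, together with their strut opposites, the integers of the form $k\cdot g+s$ (with $k\ge 0$) less than $2^{n-1}$.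
   Context: Write $\oplus$ for bitwise XOR of nonnegative integers. The $2^N$-ions: the real algebra with basis $i_0=1,i_1,\dots,i_{2^N-1}$, with $i_a^2=-1$ for $a\ne 0$, $i_ai_b=-i_bi_a=\pm i_{a\oplus b}$ for distinct nonzero $a,b$. Signs are fixed by cyclically positive triplets (trips): ''$(a,b,c)$ is a trip'' means $i_ai_b=i_c$, $i_bi_c=i_a$, $i_ci_a=i_b$. Start from the trip $(1,2,3)$ of the Quaternions ($N=2$). Passing from the $2^{k}$-ions to the $2^{k+1}$-ions ($k\ge 2$), with $H=2^{k}$: (Rule 0) all old trips are kept; (Rule 1) $(u,H,H+u)$ is a trip for $0<u<H$; (Rule 2) for every trip $(a,b,c)$ with all entries $<H$, the triples $(a,c+H,b+H)$, $(b,a+H,c+H)$, $(c,b+H,a+H)$ are trips. Emanation table (ET): for the $2^n$-ions, $n\ge 4$, let $G=2^{n-1}$ and fix a strut constant $S$ with $0<S<G$. The labels (L-indices) are the integers $u$ with $1\le u\le G-1$, $u\neq S$; rows and columns are both indexed by the labels. The strut-opposite of $u$ is $u\oplus S$. The Assessor of $u$ is the plane spanned by $i_u$ and $i_{U}$, where $U=G+(u\oplus S)$; its diagonals are the lines spanned by $i_u+i_U$ and $i_u-i_U$. Two labels $u,v$ form a DMZ if some diagonal of the Assessor of $u$ times some diagonal of the Assessor of $v$ is zero. The cell with row label $R$ and column label $C$ is filled exactly when $R,C$ form a DMZ, in which case its content is $P=R\oplus C$; otherwise it is blank. Cells with $R=C$ or $R\oplus C=S$ (the long diagonals) are always blank.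 High-bits of $S$: the powers $2^j$ occurring in the binary expansion of $S$ with $j\ge 3$ if $S$ is not a multiple of $8$, and with $j\ge 4$ if $S$ is a multiple of $8$. *)

(* Defs.v *)
From mathcomp Require Import all_boot all_order all_algebra.
From mathcomp Require Import reals.

Set Implicit Arguments.
Unset Strict Implicit.
Unset Printing Implicit Defensive.

Import GRing.Theory.

Local Open Scope nat_scope.

(* The trips of the 2^(m+2)-ions, one representative per cyclic class (applying
   Rule 2 to a rotation of a trip gives the same three new triples).
   [H] is the generator 2^k used in passing from the 2^k-ions to the
   2^(k+1)-ions, where k = m'.+2. *)
Fixpoint trips_rec (m : nat) : seq (nat * nat * nat) :=
  if m is m'.+1 then
    let H := 2 ^ m'.+2 in
    trips_rec m'
    ++ [seq (u, H, H + u) | u <- iota 1 (H - 1)]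
    ++ flatten [seq (let: (a, b, c) := t in
                     [:: (a, c + H, b + H); (b, a + H, c + H);
                         (c, b + H, a + H)])
               | t <- trips_rec m']
  else [:: (1, 2, 3)].

(* Meaningful for n >= 2. *)
Definition is_trip (n a b c : nat) : bool :=
  let T := trips_rec (n - 2) in
  [|| (a, b, c) \in T, (b, c, a) \in T | (c, a, b) \in T].

Local Open Scope ring_scope.

(* The sign in i_a i_b = +/- i_(a xor b) for the 2^n-ions.  For distinct nonzero
   a, b < 2^n exactly one of (a, b, a xor b) and (b, a, a xor b) is a trip, so
   the last case is i_a i_b = - i_b i_a = - i_(a xor b). *)
Definition ion_sign (F : realType) (n a b : nat) : F :=
  if (a == 0)%N || (b == 0)%N then 1
  else if a == b then - 1
  else if is_trip n a b (Nat.lxor a b) then 1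
  else - 1.

(* The 2^n-ions are carried by 'rV[F]_(2 ^ n); [ion F n a] is the basis element
   i_a (it is the zero vector when a >= 2^n). *)
Definition ion (F : realType) (n a : nat) : 'rV[F]_(2 ^ n) :=
  \row_(k < 2 ^ n) ((k == a :> nat)%:R).

Definition ion_mul (F : realType) (n : nat) (x y : 'rV[F]_(2 ^ n)) :
    'rV[F]_(2 ^ n) :=
  \sum_(a < 2 ^ n) \sum_(b < 2 ^ n)
    (x 0 a * y 0 b) *: (ion_sign F n a b *: ion F n (Nat.lxor a b)).

Definition is_label (n S u : nat) : Prop :=
  (1 <= u <= 2 ^ n.-1 - 1)%N /\ u <> S.

(* A generator of one of the two diagonals of the Assessor of u: the line
   spanned by i_u + i_U for e = false, by i_u - i_U for e = true, where
   U = G + (u xor S) and G = 2^(n-1). *)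
Definition diagonal (F : realType) (n S u : nat) (e : bool) : 'rV[F]_(2 ^ n) :=
  ion F n u + (-1) ^+ e *: ion F n (2 ^ n.-1 + Nat.lxor u S)%N.

(* (x <= diagonal F n S u e)%MS says that x lies on the diagonal (as a line). *)
Definition dmz (F : realType) (n S u v : nat) : Prop :=
  exists e f : bool, forall x y : 'rV[F]_(2 ^ n),
    (x <= diagonal F n S u e)%MS -> (y <= diagonal F n S v f)%MS ->
    ion_mul x y = 0.

Definition filled (F : realType) (n S R C : nat) : Prop := dmz F n S R C.

Definition off_long_diagonals (S R C : nat) : Prop :=
  Nat.lxor R C <> 0%N /\ Nat.lxor R C <> S.

Definition high_bit (S p : nat) : Prop :=
  exists j : nat, [/\ p = (2 ^ j)%N, Nat.testbit S j &
                      ((if (8 %| S)%N then 4 else 3) <= j)%N].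

(* The multiples of g below 2^(n-1), and their strut opposites. *)
Definition skybox_value (n g s x : nat) : Prop :=
  (x < 2 ^ n.-1)%N /\
  exists k : nat, x = (k * g)%N \/ x = (k * g + s)%N.

(* Main.v *)
Require Import Defs.
From Stdlib Require Import PeanoNat.
From mathcomp Require Import all_boot all_order all_algebra.
From mathcomp Require Import reals.
From mathcomp Require Import zify.

(** Multiplying the diagonals spanned by i_u +/- i_U and i_v +/- i_V produces only
    the basis elements indexed by u xor v and u xor V. Hence the cell (u, v) is
    filled exactly when a product of four signs is 1, and the doubling rule
    expresses this product one level below ([filled_quad]): the cell is filled if
    and only if an odd number of the four products i_x i_y is positive, where x is
    u or u xor S and y is v or v xor S. This parity is [quad].

    [quad] is computed by stripping top bits. A top bit H reverses the sign of
    i_x i_y whenever x or y contains it, provided the lower parts of x, y and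
    x xor y are nonzero. Suppose that no lower part of u, v, u xor v is 0 or the
    lower part of S. If H does not occur in S, it reverses either all four signs or
    none, so [quad] is unchanged; if H occurs in S, it reverses exactly three of
    them, so [quad] flips ([quad_step]). In the remaining cases one of u, v,
    u xor v is H or H xor S; by the symmetries of [quad] this may be u = H, and
    then Rule 1 gives the value [true] ([quad_generator]). [quad_top] combines the
    two cases.

    For 0 < s <= 8 this recursion gives [true] on every generic pair ([quad_le8]).
    A strut constant S with a single high-bit g is g + s with 0 < s <= 8
    ([single_high_bit]). At the bit g the flip makes [quad] false, except when one
    of u, v, u xor v is 0 or s modulo g, where it is true; the bits above g
    preserve this dichotomy ([quad_skybox]). The labels that are 0 or s modulo g
    are precisely the multiples of g and their strut opposites. *)

Set Implicit Arguments.
Unset Strict Implicit.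
Unset Printing Implicit Defensive.

Import GRing.Theory Num.Theory.

Local Open Scope nat_scope.

Local Notation "a ^^ b" := (Nat.lxor a b) (at level 45, left associativity).

(** * Bitwise xor on the naturals *)

Lemma pow_expn a n : Nat.pow a n = a ^ n.
Proof. by elim: n => //= n ->; rewrite expnS. Qed.

Lemma modulo_modn a d : Nat.modulo a d = a %% d.
Proof.
case: d => [|d]; first by rewrite modn0.
have E := Nat.div_mod_eq a d.+1.
have /ltP lt_r := Nat.mod_upper_bound a d.+1 (Nat.neq_succ_0 d).
by rewrite {2}E multE plusE mulnC modnMDl modn_small.
Qed.

(** Identities of the group (nat, xor) are decided bit by bit. *)
Ltac xor_bits :=
  apply: Nat.bits_inj => ?; rewrite ?Nat.lxor_spec ?Nat.bits_0;
  repeat match goal with |- context [Nat.testbit ?x ?k] =>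
    case: (Nat.testbit x k) end.

Lemma lxor_eq0 a b : (a ^^ b == 0) = (a == b).
Proof. by apply/eqP/eqP => /Nat.lxor_eq_0_iff. Qed.

Lemma lxorKl a b : a ^^ (a ^^ b) = b.
Proof. by xor_bits. Qed.

Lemma lxorKr a b : a ^^ b ^^ b = a.
Proof. by xor_bits. Qed.

Lemma lxor_eq a b c : (a ^^ b == c) = (a == b ^^ c).
Proof.
apply/eqP/eqP => [<-|->]; xor_bits; done.
Qed.

Lemma lxor_mod a b n : (a ^^ b) %% 2 ^ n = (a %% 2 ^ n) ^^ (b %% 2 ^ n).
Proof.
rewrite -!pow_expn -!modulo_modn; apply: Nat.bits_inj => k.
rewrite Nat.lxor_spec; case: (ltnP k n) => [/ltP|/leP] k_n.
  by rewrite !Nat.mod_pow2_bits_low // Nat.lxor_spec.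
by rewrite !Nat.mod_pow2_bits_high.
Qed.

Lemma lxor_lt n a b : a < 2 ^ n -> b < 2 ^ n -> a ^^ b < 2 ^ n.
Proof.
by move=> /modn_small <- /modn_small <-; rewrite -lxor_mod ltn_mod expn_gt0.
Qed.

(** The definitions attach a top bit with [+]; in terms of xor it becomes a
    group translation, so that [xor_bits] applies. *)
Lemma addn_lxor n a : a < 2 ^ n -> a + 2 ^ n = a ^^ 2 ^ n.
Proof.
move=> lt_a; rewrite -plusE; apply: Nat.add_nocarry_lxor.
apply: Nat.bits_inj => k; rewrite Nat.land_spec Nat.bits_0 -pow_expn.
case: (eqVneq n k) => [<-|/eqP n_k]; last first.
  by rewrite Nat.pow2_bits_false // andbF.
by rewrite -(modn_small lt_a) -pow_expn -modulo_modn Nat.mod_pow2_bits_high.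
Qed.

Lemma top_bit_split n u : u < 2 ^ n.+1 ->
  exists a (i : bool), a < 2 ^ n /\ u = a ^^ (i * 2 ^ n).
Proof.
move=> lt_u; case: (ltnP u (2 ^ n)) => [lt|le].
  by exists u, false; rewrite mul0n Nat.lxor_0_r.
exists (u - 2 ^ n), true.
have lt : u - 2 ^ n < 2 ^ n by move: lt_u; rewrite expnS; lia.
by split=> //; rewrite mul1n -addn_lxor // subnK.
Qed.

(** * Orientation of a trip and its top-bit recursion *)

Lemma trips_rec_bound m a b c : (a, b, c) \in trips_rec m ->
  [/\ 0 < a < 2 ^ m.+2, 0 < b < 2 ^ m.+2 & 0 < c < 2 ^ m.+2].
Proof.
elim: m a b c => [|m IH] a b c /=.
  by rewrite inE => /eqP [-> -> ->].
rewrite !mem_cat (expnS 2 m.+2); set H := 2 ^ m.+2 in IH *.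
case/or3P => [/IH|/mapP[u]|/flatten_mapP[[[x y] z] /IH]].
- by case=> ? ? ?; split; lia.
- by rewrite mem_iota => ? [-> -> ->]; split; lia.
case=> ? ? ?; rewrite !inE => /or3P[] /eqP[-> -> ->]; split; lia.
Qed.

Lemma is_trip_cycle n a b c : is_trip n b c a = is_trip n a b c.
Proof.
by rewrite /is_trip /=; case: (_ \in _) (_ \in _) (_ \in _) => [] [] [].
Qed.

Lemma is_trip_bound n a b c : 1 < n -> is_trip n a b c ->
  [/\ 0 < a < 2 ^ n, 0 < b < 2 ^ n & 0 < c < 2 ^ n].
Proof.
case: n => [//|[//|n]] _; rewrite /is_trip !subSS subn0.
by case/or3P => /trips_rec_bound[].
Qed.

Lemma is_trip_low n a b c : 1 < n -> a < 2 ^ n -> b < 2 ^ n -> c < 2 ^ n ->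
  is_trip n.+1 a b c = is_trip n a b c.
Proof.
case: n => [//|[//|n]] _ a_lt b_lt c_lt; rewrite /is_trip !subSS !subn0.
suff E x y z : x < 2 ^ n.+2 -> y < 2 ^ n.+2 -> z < 2 ^ n.+2 ->
    ((x, y, z) \in trips_rec n.+1) = ((x, y, z) \in trips_rec n).
  by rewrite !E.
move=> x_lt y_lt z_lt; rewrite /= !mem_cat; set H := 2 ^ n.+2 in x_lt y_lt z_lt *.
case: (_ \in trips_rec n) => //=; apply/negP.
case/orP => [/mapP[u] _ [_]|/flatten_mapP[[[p q] r] _]]; first lia.
by rewrite !inE => /or3P[] /eqP[]; lia.
Qed.

(** In a triple a, b, c with a xor b = c, either no entry or exactly two contain
    the top bit. After a rotation the low entry comes first; Rule 2 then reverses
    the lower triple, and Rule 1 supplies the triples whose lower part has a zero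
    in second position. *)
Lemma is_trip_high n a b c : 1 < n -> a < 2 ^ n -> b < 2 ^ n -> c < 2 ^ n ->
  is_trip n.+1 a (b ^^ 2 ^ n) (c ^^ 2 ^ n) =
  is_trip n a c b || [&& b == 0, c == a & a != 0].
Proof.
move=> n_gt1 a_lt b_lt c_lt; rewrite -!addn_lxor //.
case: n n_gt1 a_lt b_lt c_lt => [//|[//|n]] _.
rewrite /is_trip !subSS !subn0 /= !mem_cat; set H := 2 ^ n.+2.
move=> a_lt b_lt c_lt.
have bd x y z : (x, y, z) \in trips_rec n -> [/\ 0 < x < H, 0 < y < H & 0 < z < H].
  exact: trips_rec_bound.
apply/idP/idP.
- case/or3P => /or3P[].
  + by case/bd; lia.
  + case/mapP => u; rewrite mem_iota => u_bd [] ? ? ?.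
    by apply/orP; right; apply/and3P; split; lia.
  + case/flatten_mapP => [[[p q] r] t_in]; have [? ? ?] := bd _ _ _ t_in.
    rewrite !inE => /or3P[] /eqP[] e1 e2 e3.
    * have [? ? ?] : [/\ a = p, b = r & c = q] by split; lia.
      by subst; rewrite t_in.
    * have [? ? ?] : [/\ a = q, b = p & c = r] by split; lia.
      by subst; rewrite t_in !orbT.
    * have [? ? ?] : [/\ a = r, b = q & c = p] by split; lia.
      by subst; rewrite t_in !orbT.
  + by case/bd; lia.
  + by case/mapP => u; rewrite mem_iota => u_bd [] ? ? ?; lia.
  + case/flatten_mapP => [[[p q] r] t_in]; have [? ? ?] := bd _ _ _ t_in.
    by rewrite !inE => /or3P[] /eqP[] e1 e2 e3; lia.
  + by case/bd; lia.
  + by case/mapP => u; rewrite mem_iota => u_bd [] ? ? ?; lia.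
  + case/flatten_mapP => [[[p q] r] t_in]; have [? ? ?] := bd _ _ _ t_in.
    by rewrite !inE => /or3P[] /eqP[] e1 e2 e3; lia.
case/orP => [/or3P[] t_in|/and3P[/eqP-> /eqP-> a_gt0]].
- apply/orP; left; apply/or3P/Or33/flatten_mapP; exists (a, c, b) => //.
  by rewrite !inE eqxx.
- apply/orP; left; apply/or3P/Or33/flatten_mapP; exists (c, b, a) => //.
  by rewrite !inE eqxx !orbT.
- apply/orP; left; apply/or3P/Or33/flatten_mapP; exists (b, a, c) => //.
  by rewrite !inE eqxx !orbT.
apply/orP; left; apply/or3P/Or32/mapP; exists a; last by rewrite add0n addnC.
by rewrite mem_iota; lia.
Qed.

(** For distinct nonzero [a], [b] below 2^n: i_a i_b = + i_(a xor b). *)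
Definition positive n a b := is_trip n a b (a ^^ b).

Lemma positive_cycle n a b : positive n b (a ^^ b) = positive n a b.
Proof.
rewrite /positive (_ : b ^^ (a ^^ b) = a); last by xor_bits.
exact: is_trip_cycle.
Qed.

Section TopBit.
Variables (n a b : nat).
Hypotheses (n_gt1 : 1 < n) (a_lt : a < 2 ^ n) (b_lt : b < 2 ^ n).
Local Notation H := (2 ^ n).

Lemma positive_low : positive n.+1 a b = positive n a b.
Proof. by apply: is_trip_low => //; apply: lxor_lt. Qed.

Lemma positive_lh :
  positive n.+1 a (b ^^ H) = positive n b a || (b == 0) && (a != 0).
Proof.
rewrite /positive -Nat.lxor_assoc is_trip_high ?lxor_lt //.
rewrite is_trip_cycle (Nat.lxor_comm b a).
by case: (eqVneq b 0) => //= ->; rewrite Nat.lxor_0_r eqxx.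
Qed.

Lemma positive_hl :
  positive n.+1 (a ^^ H) b = positive n b a || (a == b) && (b != 0).
Proof.
rewrite /positive -is_trip_cycle (_ : a ^^ H ^^ b = a ^^ b ^^ H); last by xor_bits.
rewrite is_trip_high ?lxor_lt // (Nat.lxor_comm b a) lxor_eq0.
by case: (a == b).
Qed.

Lemma positive_hh :
  positive n.+1 (a ^^ H) (b ^^ H) = positive n b a || (a == 0) && (b != 0).
Proof.
rewrite /positive (_ : a ^^ H ^^ (b ^^ H) = a ^^ b); last by xor_bits.
rewrite is_trip_cycle is_trip_high ?lxor_lt // -is_trip_cycle.
rewrite (Nat.lxor_comm b a).
by case: (eqVneq a 0) => //= ->; rewrite Nat.lxor_0_l eqxx.
Qed.
End TopBit.

(** No trip contains zero, which fixes the value where [positive] has no meaning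
    as a sign; the top-bit formulas refer to it. *)
Lemma positive_degenerate n a b : 1 < n ->
  [|| a == 0, b == 0 | a == b] -> positive n a b = false.
Proof.
move=> n_gt1 deg; apply/negP => /(is_trip_bound n_gt1)[a_gt0 b_gt0].
by case/andP; rewrite lt0n lxor_eq0; move: deg; lia.
Qed.

(** Exactly one of the two orientations of {a, b, a xor b} is a trip. The top-bit
    formulas are symmetric under the exchange of a and b except on degenerate
    lower parts, where the Rule 1 terms make up the difference. *)
Lemma positive_anti n a b : 1 < n -> a < 2 ^ n -> b < 2 ^ n ->
  a != 0 -> b != 0 -> a != b -> positive n b a = ~~ positive n a b.
Proof.
elim: n a b => [//|[//|n] IH] a b _.
have [->|n_gt0] := posnP n.
  by case: a => [|[|[|[|a]]]]; case: b => [|[|[|[|b]]]].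
have {IH}IH := IH _ _ (n_gt0 : 1 < n.+1).
case/top_bit_split => {}a [i [a_lt ->]] /top_bit_split[{}b [j [b_lt ->]]].
have anti : a != 0 -> b != 0 -> a != b ->
    positive n.+1 b a = ~~ positive n.+1 a b by apply: IH.
have deg x y := @positive_degenerate n.+1 x y n_gt0.
case: i; case: j; rewrite ?mul0n ?mul1n ?Nat.lxor_0_r.
- rewrite !positive_hh // !lxor_eq0.
  rewrite -[_ ^^ _ == _ ^^ _]lxor_eq0 (_ : _ ^^ _ ^^ (_ ^^ _) = a ^^ b); last first.
    by xor_bits.
  rewrite lxor_eq0 => _ _ a_b.
  have [a0|a0] := eqVneq a 0; first by rewrite !deg ?a0 ?eqxx ?orbT //; lia.
  have [b0|b0] := eqVneq b 0; first by rewrite !deg ?b0 ?eqxx ?orbT //; lia.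
  by rewrite anti //= ?orbF ?negbK.
- rewrite positive_hl // positive_lh // => _ b0 _.
  have [a0|a0] := eqVneq a 0; first by rewrite !deg ?a0 ?eqxx ?orbT //; lia.
  have [ab|ab] := eqVneq a b; first by rewrite !deg ?ab ?eqxx ?orbT //; lia.
  by rewrite anti //= ?orbF ?negbK.
- rewrite positive_hl // positive_lh // (eq_sym b a) => a0 _ _.
  have [b0|b0] := eqVneq b 0; first by rewrite !deg ?b0 ?eqxx ?orbT //; lia.
  have [ab|ab] := eqVneq a b; first by rewrite !deg ?ab ?eqxx ?orbT //; lia.
  by rewrite anti //= ?orbF ?negbK.
by rewrite (@positive_low n.+1 a b) // (@positive_low n.+1 b a).
Qed.

(** The unified form of the recursion away from degenerate lower parts: adding
    a top bit reverses the orientation as soon as it occurs on the line. *)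
Lemma positive_top n a b (i j : bool) : 1 < n -> a < 2 ^ n -> b < 2 ^ n ->
  a != 0 -> b != 0 -> a != b ->
  positive n.+1 (a ^^ (i * 2 ^ n)) (b ^^ (j * 2 ^ n)) =
  (i || j) (+) positive n a b.
Proof.
move=> n_gt1 a_lt b_lt a0 b0 ab.
have anti := positive_anti n_gt1 a_lt b_lt a0 b0 ab.
case: i; case: j; rewrite ?mul0n ?mul1n ?Nat.lxor_0_r.
- by rewrite positive_hh // (negPf a0) andFb orbF anti.
- by rewrite positive_hl // (negPf ab) andFb orbF anti.
- by rewrite positive_lh // (negPf b0) andFb orbF anti.
by rewrite positive_low.
Qed.

(** * Quadruples of strut-opposite pairs *)

(** None of u, v, u xor v is 0 or S: for S nonzero, the subgroup generated by
    u, v and S has eight elements. *)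
Definition generic S u v :=
  [&& u != 0, v != 0, u != v, u != S, v != S & u ^^ v != S].

(** The parity of the positive products among the four pairs formed from u or its
    strut-opposite and v or its strut-opposite. *)
Definition quad n S u v :=
  positive n u v (+) positive n (u ^^ S) v (+)
  (positive n u (v ^^ S) (+) positive n (u ^^ S) (v ^^ S)).

Lemma generic_sym S u v : generic S u v = generic S v u.
Proof.
by rewrite /generic (Nat.lxor_comm u v) (eq_sym u v); do 6 case: (_ != _).
Qed.

Lemma generic_opp S u v : generic S u v -> generic S (u ^^ S) v.
Proof.
rewrite /generic !lxor_eq0 => /and5P[u0 v0 uv uS /andP[vS uvS]].
rewrite !(lxor_eq u S) Nat.lxor_nilpotent uS v0 u0 vS /=.
rewrite (Nat.lxor_comm S v) -lxor_eq uvS /=.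
by rewrite (_ : u ^^ S ^^ v = u ^^ v ^^ S) ?lxor_eq ?Nat.lxor_nilpotent
     ?Nat.lxor_0_r //; xor_bits.
Qed.

Lemma generic_third S u v : generic S u v -> generic S u (u ^^ v).
Proof.
rewrite /generic -(lxor_eq0 u (u ^^ v)) !lxorKl lxor_eq0.
by case/and5P => -> -> -> -> /andP[-> ->].
Qed.

Lemma quad_opp n S u v : quad n S (u ^^ S) v = quad n S u v.
Proof. by rewrite /quad !lxorKr; do 4 case: (positive _ _ _). Qed.

(** On generic pairs [quad] depends only on S and on the subgroup generated by
    u, v and S. With [quad_opp], the two symmetries of this section allow any one
    of u, v, u xor v and their strut-opposites to be moved to the first position;
    each works because it reverses all four orientations at once. *)
Section QuadSymmetry.
Variables (n S u v : nat).
Hypotheses (n_gt1 : 1 < n) (S_lt : S < 2 ^ n) (u_lt : u < 2 ^ n) (v_lt : v < 2 ^ n).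
Hypothesis gen : generic S u v.

Let sgn_anti x y : x \in [:: u; u ^^ S] -> y \in [:: v; v ^^ S] ->
  positive n y x = ~~ positive n x y.
Proof.
rewrite !inE => x_in y_in.
have x_lt : x < 2 ^ n by case/orP: x_in => /eqP->; rewrite ?lxor_lt.
have y_lt : y < 2 ^ n by case/orP: y_in => /eqP->; rewrite ?lxor_lt.
suff /and5P[? ? ? _ _] : generic S x y by apply: positive_anti.
case/orP: x_in => /eqP->; case/orP: y_in => /eqP-> //.
- by rewrite generic_sym; apply: generic_opp; rewrite generic_sym.
- exact: generic_opp.
by apply/generic_opp; rewrite generic_sym; apply: generic_opp; rewrite generic_sym.
Qed.

Lemma quad_sym : quad n S v u = quad n S u v.
Proof.
rewrite /quad (@sgn_anti u v) ?(@sgn_anti u (v ^^ S)) ?(@sgn_anti (u ^^ S) v) //;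
  rewrite ?(@sgn_anti (u ^^ S) (v ^^ S)) ?inE ?eqxx ?orbT //.
by do 4 case: (positive _ _ _).
Qed.

Lemma quad_third : quad n S u (u ^^ v) = quad n S u v.
Proof.
have third x y : x \in [:: u; u ^^ S] -> y \in [:: v; v ^^ S] ->
    positive n x (x ^^ y) = ~~ positive n x y.
  by move=> xu yv; rewrite -sgn_anti // Nat.lxor_comm positive_cycle.
have -> : quad n S u (u ^^ v) =
    positive n u (u ^^ v) (+) positive n (u ^^ S) (u ^^ S ^^ (v ^^ S)) (+)
    (positive n u (u ^^ (v ^^ S)) (+) positive n (u ^^ S) (u ^^ S ^^ v)).
  by rewrite /quad; congr (_ (+) positive _ _ _ (+)
    (positive _ _ _ (+) positive _ _ _)); xor_bits.
rewrite (@third u v) ?(@third u (v ^^ S)) ?(@third (u ^^ S) v) //;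
  rewrite ?(@third (u ^^ S) (v ^^ S)) ?inE ?eqxx ?orbT //.
by rewrite /quad; do 4 case: (positive _ _ _).
Qed.
End QuadSymmetry.
Lemma quad_oppr n S u v : quad n S u (v ^^ S) = quad n S u v.
Proof. by rewrite /quad !lxorKr; do 4 case: (positive _ _ _). Qed.

Lemma lxor_add_top n a b (i j : bool) :
  a ^^ (i * 2 ^ n) ^^ (b ^^ (j * 2 ^ n)) = a ^^ b ^^ ((i (+) j) * 2 ^ n).
Proof. by case: i; case: j; rewrite ?mul0n ?mul1n ?Nat.lxor_0_r; xor_bits. Qed.

(** Adding a top bit reverses the pairs in which it occurs. If S does not contain
    it, either all four pairs contain it or none; if S does, exactly three of the
    four contain it. *)
Lemma quad_step n s a b (k i j : bool) : 1 < n ->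
  s < 2 ^ n -> a < 2 ^ n -> b < 2 ^ n -> generic s a b ->
  quad n.+1 (s ^^ (k * 2 ^ n)) (a ^^ (i * 2 ^ n)) (b ^^ (j * 2 ^ n)) =
  k (+) quad n s a b.
Proof.
move=> n_gt1 s_lt a_lt b_lt gen; rewrite /quad !lxor_add_top.
have top x y (i' j' : bool) : x < 2 ^ n -> y < 2 ^ n -> generic s x y ->
    positive n.+1 (x ^^ (i' * 2 ^ n)) (y ^^ (j' * 2 ^ n)) =
    (i' || j') (+) positive n x y.
  by move=> x_lt y_lt /and4P[x0 y0 xy _]; apply: positive_top.
have genr x : generic s x b -> generic s x (b ^^ s).
  by rewrite generic_sym => /generic_opp; rewrite generic_sym.
have gena := generic_opp gen.
rewrite !top ?lxor_lt ?genr //.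
by case: k; case: i; case: j; do 4 case: (positive _ _ _).
Qed.

(** When u is the top bit H itself, Rule 1 settles the two signs in which H is a
    factor, and the two others are given by the orientation of {s, b, b xor s},
    up to reversal, by [rot]. If S is below H, the first two agree and the others
    are opposite; if S contains H, the first two are opposite and the others
    agree. *)
Section Generator.
Variables (n s b : nat).
Hypotheses (n_gt1 : 1 < n) (s_lt : s < 2 ^ n) (b_lt : b < 2 ^ n).
Hypotheses (s0 : s != 0) (b0 : b != 0) (bs : b != s).
Local Notation H := (2 ^ n).

Let zero_lt : 0 < H. Proof. by rewrite expn_gt0. Qed.
Let bs_lt : b ^^ s < H. Proof. exact: lxor_lt. Qed.
Let bs0 : b ^^ s != 0. Proof. by rewrite lxor_eq0. Qed.
Let H_top : H = 0 ^^ H. Proof. by rewrite Nat.lxor_0_l. Qed.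
Let rot : positive n (b ^^ s) s = positive n s b.
Proof. by rewrite -positive_cycle lxorKr. Qed.

Let positive_H x : x < H -> positive n.+1 H x = false.
Proof.
move=> x_lt; rewrite H_top positive_hl // positive_degenerate ?eqxx ?orbT //.
by case: eqP => //= <-.
Qed.

Lemma quad_generator_low : quad n.+1 s H b.
Proof.
have positive_Hs x : x < H -> x != s -> positive n.+1 (H ^^ s) x = positive n x s.
  by move=> ? xs; rewrite Nat.lxor_comm positive_hl // eq_sym (negPf xs) orbF.
have bs_s : b ^^ s != s by rewrite lxor_eq Nat.lxor_nilpotent.
rewrite /quad !positive_H // !positive_Hs // rot.
by rewrite (positive_anti n_gt1 b_lt s_lt) //; case: positive.
Qed.

Lemma quad_generator_high : quad n.+1 (s ^^ H) H b.
Proof.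
rewrite /quad (_ : H ^^ (s ^^ H) = s); last by xor_bits.
rewrite -Nat.lxor_assoc positive_H // (positive_low n_gt1 s_lt b_lt).
rewrite (positive_lh n_gt1 s_lt bs_lt) rot.
have := positive_hh n_gt1 zero_lt bs_lt; rewrite Nat.lxor_0_l eqxx bs0 orbT => ->.
rewrite (negPf bs0) orbF.
by case: positive.
Qed.
End Generator.

(** The symmetries of [quad] bring v below the top bit: u xor v replaces v when S
    does not contain the top bit, the strut-opposite of v when it does. *)
Lemma quad_generator n S v : 1 < n -> S < 2 ^ n.+1 -> v < 2 ^ n.+1 ->
  S != 0 -> generic S (2 ^ n) v -> quad n.+1 S (2 ^ n) v.
Proof.
move=> n_gt1 S_lt v_lt S0 gen.
have H_lt : 2 ^ n < 2 ^ n.+1 by rewrite ltn_exp2l.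
have n1_gt1 : 1 < n.+1 by apply: ltnW.
case/top_bit_split: (S_lt) => s [k [s_lt eS]].
case/top_bit_split: (v_lt) => b [j [b_lt ev]].
have [_ v0 Hv HS /andP[vS HvS]] := and5P gen.
case: k eS => [|]; rewrite ?mul1n ?mul0n ?Nat.lxor_0_r => eS;
  case: j ev => [|]; rewrite ?mul1n ?mul0n ?Nat.lxor_0_r => ev.
- rewrite -quad_oppr (_ : v ^^ S = b ^^ s); last by rewrite ev eS; xor_bits.
  rewrite eS; apply: quad_generator_high => //; first exact: lxor_lt.
  rewrite lxor_eq Nat.lxor_nilpotent.
  by apply: contra_neq Hv => e; rewrite ev e Nat.lxor_0_l.
- rewrite eS ev; apply: quad_generator_high => //.
  by apply: contra_neq HvS => e; rewrite ev eS e Nat.lxor_comm.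
- rewrite -quad_third // (_ : 2 ^ n ^^ v = b); last by rewrite ev; xor_bits.
  rewrite eS; apply: quad_generator_low => //; first by rewrite -eS.
  + by apply: contra_neq Hv => e; rewrite ev e Nat.lxor_0_l.
  + by apply: contra_neq HvS => e; rewrite ev e eS; xor_bits.
by subst; apply: quad_generator_low.
Qed.

(** If u vanishes modulo S below the top bit without vanishing altogether, then
    the top bit is u or its strut-opposite. *)
Lemma quad_degenerate n s u v a (k i : bool) : 1 < n -> s < 2 ^ n ->
  u < 2 ^ n.+1 -> v < 2 ^ n.+1 -> s ^^ (k * 2 ^ n) != 0 ->
  generic (s ^^ (k * 2 ^ n)) u v -> u = a ^^ (i * 2 ^ n) ->
  (a == 0) || (a == s) -> quad n.+1 (s ^^ (k * 2 ^ n)) u v.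
Proof.
move=> n_gt1 s_lt u_lt v_lt; set S := s ^^ (k * 2 ^ n) => S0 gen eu a_deg.
have S_lt : S < 2 ^ n.+1.
  have lt : 2 ^ n < 2 ^ n.+1 by rewrite ltn_exp2l.
  by apply: lxor_lt; [apply: ltn_trans lt|case: (k); rewrite ?mul1n ?mul0n ?expn_gt0].
have [u0 _ _ uS _] := and5P gen.
have [uH|uH] : u = 2 ^ n \/ u ^^ S = 2 ^ n.
  case/orP: a_deg => /eqP ea; subst a.
    left; case: i eu u0 => ->; rewrite ?mul1n ?mul0n ?Nat.lxor_0_l //.
  right; rewrite eu lxor_add_top Nat.lxor_nilpotent Nat.lxor_0_l.
  suff -> : i (+) k by rewrite mul1n.
  apply: contraR uS => /negPf ik; rewrite eu /S (_ : i = k) //.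
  by case: (i) (k) ik => [] [].
- by rewrite uH; apply: quad_generator => //; rewrite -uH.
rewrite -quad_opp uH; apply: quad_generator => //.
by rewrite -uH; apply: generic_opp.
Qed.

(** A degenerate lower part concerns u, v or u xor v, and the symmetries of [quad]
    put the one concerned first. *)
Lemma quad_top n s a b (k i j : bool)
    (S := s ^^ (k * 2 ^ n)) (u := a ^^ (i * 2 ^ n)) (v := b ^^ (j * 2 ^ n)) :
  1 < n -> s < 2 ^ n -> a < 2 ^ n -> b < 2 ^ n -> S != 0 -> generic S u v ->
  quad n.+1 S u v = ~~ generic s a b || (k (+) quad n s a b).
Proof.
move=> n_gt1 s_lt a_lt b_lt S0 gen.
have lt x (l : bool) : x < 2 ^ n -> x ^^ (l * 2 ^ n) < 2 ^ n.+1.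
  have lt2 : 2 ^ n < 2 ^ n.+1 by rewrite ltn_exp2l.
  move=> x_lt; apply: lxor_lt; first exact: ltn_trans lt2.
  by case: l; rewrite ?mul1n ?mul0n ?expn_gt0.
have [S_lt u_lt v_lt] : [/\ S < 2 ^ n.+1, u < 2 ^ n.+1 & v < 2 ^ n.+1].
  by split; apply: lt.
have n1_gt1 : 1 < n.+1 by apply: ltnW.
have [low|/= deg] := boolP (generic s a b); first exact: quad_step.
suff -> : quad n.+1 S u v by [].
have deg3 : [|| (a == 0) || (a == s), (b == 0) || (b == s) |
               (a ^^ b == 0) || (a ^^ b == s)].
  by move: deg; rewrite /generic !negb_and !negbK lxor_eq0; do 6 case: eqP.
case/or3P: deg3 => deg1; first exact: (@quad_degenerate n s u v a k i).
  rewrite -quad_sym //.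
  by apply: (@quad_degenerate n s v u b k j); rewrite // generic_sym.
have uv_lt : u ^^ v < 2 ^ n.+1 by apply: lxor_lt.
rewrite -quad_third // quad_sym //; 
  last by rewrite generic_sym; apply: generic_third.
apply: (@quad_degenerate n s (u ^^ v) u (a ^^ b) k (i (+) j)) => //.
- by rewrite generic_sym; apply: generic_third.
exact: lxor_add_top.
Qed.

(** A group of order four has no room for a subgroup of order eight. *)
Lemma generic_tiny s a b : s < 4 -> a < 4 -> b < 4 -> s != 0 -> ~~ generic s a b.
Proof.
by case: s => [|[|[|[|?]]]] //; case: a => [|[|[|[|?]]]] //;
  case: b => [|[|[|[|?]]]].
Qed.

(** The induction on the top bit starts with no generic pair at all. The value
    [true] would be lost only at the leading bit of S, if the lower parts were
    generic and their [quad] were true. For S = 4 and S = 8 the lower strut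
    constant is 0, and the four terms of [quad] coincide; for 4 < S < 8 the lower
    parts are too small to be generic. *)
Lemma quad_le8 n S u v : 1 < n -> S < 2 ^ n -> u < 2 ^ n -> v < 2 ^ n ->
  0 < S <= 8 -> generic S u v -> quad n S u v.
Proof.
elim: n S u v => [//|[//|n] IH] S u v _ S_lt u_lt v_lt S_le8 gen.
have S0 : S != 0 by lia.
have [n0|n_gt0] := posnP n.
  by subst n; case/negP: (generic_tiny S_lt u_lt v_lt S0).
case/top_bit_split: S_lt => s [k [s_lt eS]].
case/top_bit_split: u_lt => a [i [a_lt eu]].
case/top_bit_split: v_lt => b [j [b_lt ev]].
rewrite eS eu ev quad_top -?eS -?eu -?ev //.
have [low|//] := boolP (generic s a b).
case: k eS => [|]; rewrite ?mul1n ?mul0n ?Nat.lxor_0_r => eS /=; last first.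
  by apply: IH; rewrite // -eS.
rewrite -addn_lxor // in eS.
have [n1|n_gt1] := eqVneq n 1.
  subst n; have [s0|s0] := eqVneq s 0; last first.
    by case/negP: (generic_tiny s_lt a_lt b_lt s0).
  by rewrite s0 /quad !Nat.lxor_0_r; do 2 case: positive.
have le8 : 2 ^ 3 <= 2 ^ n.+1 by rewrite leq_exp2l //; lia.
have s0 : s = 0 by lia.
by rewrite s0 /quad !Nat.lxor_0_r; do 2 case: positive.
Qed.

(** At the leading bit of S the three reversals turn the constant value [true] of
    [quad_le8] into [false], save for degenerate residues. Every higher bit leaves
    generic values unchanged, and a pair that is degenerate there is degenerate
    modulo 2^p as well. *)
Lemma quad_skybox p s m u v (S := s ^^ 2 ^ p) : 1 < p -> 0 < s <= 8 ->
  s < 2 ^ p -> p < m -> u < 2 ^ m -> v < 2 ^ m -> generic S u v ->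
  quad m S u v = ~~ generic s (u %% 2 ^ p) (v %% 2 ^ p).
Proof.
move=> p_gt1 s_le8 s_lt.
have S_lt : S < 2 ^ p.+1 by rewrite /S -addn_lxor // expnS; lia.
have S0 : S != 0 by rewrite /S -addn_lxor //; lia.
have modS : S %% 2 ^ p = s by rewrite /S -addn_lxor // modnDr modn_small.
have mod_top x q (i : bool) : p <= q -> (x ^^ (i * 2 ^ q)) %% 2 ^ p = x %% 2 ^ p.
  move=> /subnKC <-; rewrite lxor_mod expnD mulnCA modnMr.
  by rewrite Nat.lxor_0_r.
elim: m u v => [//|m IH] u v; rewrite ltnS leq_eqVlt => /predU1P[<-|p_m].
  case/top_bit_split => a [i [a_lt ->]] /top_bit_split[b [j [b_lt ->]]].
  rewrite !mod_top // !modn_small //.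
  have := @quad_top p s a b true i j; rewrite mul1n => top gen.
  rewrite top //; case: (boolP (generic s a b)) => //= low.
  by rewrite quad_le8.
case/top_bit_split => a [i [a_lt ->]] /top_bit_split[b [j [b_lt ->]]].
have S_ltm : S < 2 ^ m by apply: leq_trans S_lt _; rewrite leq_exp2l.
have := @quad_top m S a b false i j; rewrite mul0n Nat.lxor_0_r => top gen.
rewrite top ?(leq_trans p_gt1 (ltnW p_m)) // !mod_top ?(ltnW p_m) //.
case: (boolP (generic S a b)) => [low|deg] /=; first by rewrite IH.
apply/esym; apply: contra deg.
case/and5P=> a0 b0 ab a_s /andP[b_s ab_s].
apply/and5P; split; last (apply/andP; split).
- by apply: contra_neq a0 => ->; rewrite mod0n.
- by apply: contra_neq b0 => ->; rewrite mod0n.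
- by apply: contra_neq ab => ->.
- by apply: contra_neq a_s => ->.
- by apply: contra_neq b_s => ->.
by apply: contra_neq ab_s => e; rewrite -lxor_mod e.
Qed.

(** * Products of diagonals *)

Section Ions.
Variables (F : realType) (n : nat).
Local Open Scope ring_scope.

Lemma ion_mulDl (x x' y : 'rV[F]_(2 ^ n)) :
  ion_mul (x + x') y = ion_mul x y + ion_mul x' y.
Proof.
rewrite /ion_mul -big_split; apply: eq_bigr => a _.
by rewrite -big_split; apply: eq_bigr => b _; rewrite mxE mulrDl scalerDl.
Qed.

Lemma ion_mulDr (x y y' : 'rV[F]_(2 ^ n)) :
  ion_mul x (y + y') = ion_mul x y + ion_mul x y'.
Proof.
rewrite /ion_mul -big_split; apply: eq_bigr => a _.
by rewrite -big_split; apply: eq_bigr => b _; rewrite mxE mulrDr scalerDl.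
Qed.

Lemma ion_mulZl c (x y : 'rV[F]_(2 ^ n)) : ion_mul (c *: x) y = c *: ion_mul x y.
Proof.
rewrite /ion_mul scaler_sumr; apply: eq_bigr => a _.
by rewrite scaler_sumr; apply: eq_bigr => b _; rewrite mxE -mulrA [RHS]scalerA.
Qed.

Lemma ion_mulZr c (x y : 'rV[F]_(2 ^ n)) : ion_mul x (c *: y) = c *: ion_mul x y.
Proof.
rewrite /ion_mul scaler_sumr; apply: eq_bigr => a _.
by rewrite scaler_sumr; apply: eq_bigr => b _; rewrite mxE mulrCA [RHS]scalerA.
Qed.

Lemma ion_mul_ion a b : (a < 2 ^ n)%N -> (b < 2 ^ n)%N ->
  ion_mul (ion F n a) (ion F n b) = ion_sign F n a b *: ion F n (a ^^ b).
Proof.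
move=> a_lt b_lt; rewrite /ion_mul.
rewrite (bigD1 (Ordinal a_lt)) //= [X in _ + X]big1 ?addr0; last first.
  move=> i /negPf; rewrite -val_eqE /= => i_a; rewrite big1 // => j _.
  by rewrite !mxE i_a mul0r scale0r.
rewrite (bigD1 (Ordinal b_lt)) //= [X in _ + X]big1 ?addr0; last first.
  by move=> j /negPf; rewrite -val_eqE /= => j_b; rewrite !mxE j_b mulr0 scale0r.
by rewrite !mxE !eqxx mulr1 scale1r.
Qed.

Lemma ion_free a b (x y : F) : (a < 2 ^ n)%N -> (b < 2 ^ n)%N -> a != b ->
  x *: ion F n a + y *: ion F n b = 0 <-> x = 0 /\ y = 0.
Proof.
move=> a_lt b_lt a_b; split=> [E|[-> ->]]; last by rewrite !scale0r addr0.
split.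
  have /rowP/(_ (Ordinal a_lt)) := E.
  by rewrite !mxE eqxx (negPf a_b) mulr1 mulr0 addr0.
have /rowP/(_ (Ordinal b_lt)) := E.
by rewrite !mxE eqxx (eq_sym b) (negPf a_b) mulr1 mulr0 add0r.
Qed.

Lemma ion_sign_positive a b : a != 0%N -> b != 0%N -> a != b ->
  ion_sign F n a b = (-1) ^+ ~~ positive n a b.
Proof.
rewrite /ion_sign /positive => /negPf-> /negPf-> /negPf-> /=.
by case: is_trip; rewrite ?expr0 ?expr1.
Qed.

Lemma signr_sum_eq0 (b c : bool) :
  ((-1) ^+ b + (-1) ^+ c = 0 :> F) <-> b (+) c.
Proof.
have two0 : 1 + 1 != 0 :> F by rewrite (_ : 1 + 1 = 2%:R) ?pnatr_eq0.
split; case: b; case: c; rewrite ?expr0 ?expr1 //= ?addNr ?subrr //.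
  by rewrite -opprD => /eqP; rewrite oppr_eq0 (negPf two0).
by move/eqP; rewrite (negPf two0).
Qed.

End Ions.

(** By bilinearity it suffices to multiply generators of the diagonals. *)
Lemma dmz_generators (F : realType) n S u v : dmz F n S u v <->
  exists e f : bool, ion_mul (diagonal F n S u e) (diagonal F n S v f) = 0%R.
Proof.
split=> -[e [f E]]; exists e, f; first by apply: E; apply: submx_refl.
by move=> x y /sub_rVP[c ->] /sub_rVP[d ->]; rewrite ion_mulZl ion_mulZr E !scaler0.
Qed.

(** The product of two diagonals is a combination of two basis elements only: the
    products u v and U V contribute to i_(u xor v), and u V and U v to the other.
    Writing sg for the signs and e, f for the choice of diagonals, the coefficients
    vanish when sg(u,v) + e f sg(U,V) = 0 and f sg(u,V) + e sg(U,v) = 0. Suitable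
    e and f exist exactly when the product of the four signs is 1. Rule 2 reverses
    three of these signs, hence an odd value of [quad] one level below. *)
Lemma filled_quad (F : realType) m S u v : 1 < m ->
  S < 2 ^ m -> u < 2 ^ m -> v < 2 ^ m -> S != 0 -> generic S u v ->
  filled F m.+1 S u v <-> quad m S u v.
Proof.
move=> m_gt1 S_lt u_lt v_lt S0 gen; rewrite /filled dmz_generators.
pose U := u ^^ S ^^ 2 ^ m; pose V := v ^^ S ^^ 2 ^ m.
have [u0 v0 uv uS /andP[vS uvS]] := and5P gen.
have u'_lt := lxor_lt u_lt S_lt; have v'_lt := lxor_lt v_lt S_lt.
have diagE x e : x < 2 ^ m -> diagonal F m.+1 S x e =
    (ion F m.+1 x + (-1) ^+ e *: ion F m.+1 (x ^^ S ^^ 2 ^ m))%R.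
  by move=> x_lt; rewrite /diagonal /= addnC addn_lxor // lxor_lt.
have lt2 : 2 ^ m < 2 ^ m.+1 by rewrite ltn_exp2l.
have lt_top x : x < 2 ^ m -> x < 2 ^ m.+1 by move=> x_lt; apply: ltn_trans lt2.
have top_neq x y : x < 2 ^ m -> y < 2 ^ m -> x ^^ 2 ^ m != y.
  by move=> x_lt y_lt; rewrite -addn_lxor //; lia.
have top0 x : x < 2 ^ m -> x ^^ 2 ^ m != 0.
  by move=> x_lt; apply: top_neq => //; rewrite expn_gt0.
have u'0 : u ^^ S != 0 by rewrite lxor_eq0.
have v'0 : v ^^ S != 0 by rewrite lxor_eq0.
have UVE : U ^^ V = u ^^ v by rewrite /U /V; xor_bits.
have UV : U != V by rewrite -lxor_eq0 UVE lxor_eq0.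
have uv' : u != v ^^ S by rewrite -lxor_eq.
have u'v : u ^^ S != v by rewrite lxor_eq Nat.lxor_comm -lxor_eq.
have u'v' : u ^^ S != v ^^ S by rewrite lxor_eq (Nat.lxor_comm v) lxorKl.
have [U0 V0] : U != 0 /\ V != 0 by split; apply: top0.
have Uv : U != v by apply: top_neq.
have uV : u != V by rewrite eq_sym; apply: top_neq.
have u_ltN := lt_top u u_lt; have v_ltN := lt_top v v_lt.
have U_lt : U < 2 ^ m.+1 by apply: lxor_lt; [apply: lt_top|].
have V_lt : V < 2 ^ m.+1 by apply: lxor_lt; [apply: lt_top|].
have topE x y (i j : bool) : x < 2 ^ m -> y < 2 ^ m -> x != 0 -> y != 0 -> x != y ->
    positive m.+1 (x ^^ (i * 2 ^ m)) (y ^^ (j * 2 ^ m)) =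
    (i || j) (+) positive m x y.
  exact: positive_top.
pose W := u ^^ v ^^ S ^^ 2 ^ m.
have prodE (e f : bool) :
  (ion_mul (diagonal F m.+1 S u e) (diagonal F m.+1 S v f) =
   ((-1) ^+ (~~ positive m u v) +
    (-1) ^+ (e (+) f (+) positive m (u ^^ S) (v ^^ S))) *: ion F m.+1 (u ^^ v) +
   ((-1) ^+ (f (+) positive m u (v ^^ S)) +
    (-1) ^+ (e (+) positive m (u ^^ S) v)) *: ion F m.+1 W)%R.
  rewrite !diagE // -/U -/V ion_mulDl !ion_mulDr !ion_mulZl !ion_mulZr.
  rewrite !ion_mul_ion //.
  rewrite UVE.
  rewrite (_ : u ^^ V = W); last by rewrite /V /W; xor_bits.
  rewrite (_ : U ^^ v = W); last by rewrite /U /W; xor_bits.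
  rewrite !ion_sign_positive //.
  have := topE u v false false; rewrite !mul0n !Nat.lxor_0_r => -> //.
  have := topE u (v ^^ S) false true; rewrite mul0n mul1n Nat.lxor_0_r => -> //.
  have := topE (u ^^ S) v true false; rewrite mul0n mul1n Nat.lxor_0_r => -> //.
  have := topE (u ^^ S) (v ^^ S) true true; rewrite !mul1n => -> //.
  rewrite /= !negbK !scalerA -!signr_addb !scalerDl.
  by rewrite [RHS]addrACA [X in (_ + X = _)%R]addrC !addrA.
have w_lt := lxor_lt u_lt v_lt; have w'_lt := lxor_lt w_lt S_lt.
have W_lt : W < 2 ^ m.+1 by apply: lxor_lt; [apply: lt_top|].
have w_ltN := lt_top _ w_lt.
have wW : u ^^ v != W by rewrite eq_sym top_neq.
have zeroE (e f : bool) :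
    ion_mul (diagonal F m.+1 S u e) (diagonal F m.+1 S v f) = 0%R <->
    ~~ positive m u v (+) (e (+) f (+) positive m (u ^^ S) (v ^^ S)) /\
    f (+) positive m u (v ^^ S) (+) (e (+) positive m (u ^^ S) v).
  by rewrite prodE ion_free // !signr_sum_eq0.
split=> [[e [f /zeroE]]|q]; last first.
  (* Only e xor f matters, so f is fixed and e solves the second condition. *)
  exists (~~ (positive m u (v ^^ S) (+) positive m (u ^^ S) v)), false.
  by apply/zeroE; move: q; rewrite /quad; do 4 case: (positive m _ _).
by rewrite /quad; case: e f => [] []; do 4 case: (positive m _ _); case.
Qed.

(** * The strut constant and the table *)

Lemma testbit_small n s j : s < 2 ^ n -> n <= j -> Nat.testbit s j = false.
Proof.
move=> s_lt /leP n_j; rewrite -(modn_small s_lt) -modulo_modn -pow_expn.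
exact: Nat.mod_pow2_bits_high.
Qed.

Lemma testbit_add_pow2 p s j : s < 2 ^ p ->
  Nat.testbit (s + 2 ^ p) j = (j == p) || (Nat.testbit s j).
Proof.
move=> s_lt; rewrite addn_lxor // Nat.lxor_spec -pow_expn.
have [->|/eqP j_p] := eqVneq j p.
  by rewrite Nat.pow2_bits_true (testbit_small s_lt).
by rewrite Nat.pow2_bits_false; [case: Nat.testbit | move=> e; apply: j_p].
Qed.

(** The leading bit of S is a high-bit. If the rest s exceeded 8, its leading bit
    would be a second one; when 8 divides S it also divides s, so that s is then
    at least 16. *)
Lemma single_high_bit S p (s := S %% 2 ^ p) : 8 < S ->
  (forall k, S <> 2 ^ k) -> 2 ^ p < S < 2 ^ p.+1 -> (exists! q, high_bit S q) ->
  [/\ 2 < p, 0 < s <= 8 & S = s ^^ 2 ^ p].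
Proof.
move=> S_gt8 S_npow S_range [q [_ q_unique]].
have eS : S = s + 2 ^ p.
  rewrite /s -{2}(@subnK (2 ^ p) S) ?modnDr ?modn_small ?subnK //; first lia.
  - by move: S_range; rewrite expnS; lia.
  - by lia.
have s_lt : s < 2 ^ p by rewrite ltn_mod expn_gt0.
have p_gt2 : 2 < p.
  rewrite ltnNge; apply/negP => p_le.
  have : 2 ^ p.+1 <= 2 ^ 3 by rewrite leq_exp2l.
  by lia.
have g_high : high_bit S (2 ^ p).
  exists p; split=> //; first by rewrite eS testbit_add_pow2 // eqxx.
  case: ifP => // S_dvd; rewrite ltn_neqAle p_gt2 andbT; apply/eqP => p3.
  by move: S_range; rewrite -p3; lia.
split=> //; last by rewrite -addn_lxor.
have s_gt0 : 0 < s by rewrite lt0n; apply/eqP => s0; apply: (S_npow p); lia.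
rewrite s_gt0 /= leqNgt; apply/negP => s_gt8.
have log_le b : (b <= Nat.log2 s) = (2 ^ b <= s).
  have := Nat.log2_le_pow2 s b; rewrite pow_expn => E.
  by apply/leP/leP => h; apply E => //; apply/ltP.
have j_lt : Nat.log2 s < p by rewrite ltnNge log_le -ltnNge.
have : high_bit S (2 ^ Nat.log2 s).
  exists (Nat.log2 s); split=> //.
    by rewrite eS testbit_add_pow2 // Nat.bit_log2 ?orbT //; lia.
  rewrite log_le; case: ifP => [S_dvd|_]; last exact: ltnW.
  have g_dvd : 8 %| 2 ^ p by rewrite (dvdn_exp2l 2 p_gt2).
  by move: S_dvd; rewrite eS dvdn_addl //; lia.
move/q_unique => e; have /eqP := q_unique _ g_high.
by rewrite e eqn_exp2l // ltn_eqF.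
Qed.

Lemma genericPn s a b : ~~ generic s a b <->
  exists x, (x = a \/ x = b \/ x = a ^^ b) /\ (x = 0 \/ x = s).
Proof.
rewrite /generic !negb_and !negbK -(lxor_eq0 a b).
split=> [|[x [x_in x_val]]]; last first.
  case: x_in => [<-|[<-|<-]]; case: x_val => ->; rewrite ?eqxx ?orbT //.
by case/or4P=> [/eqP|/eqP|/eqP|/or3P[]/eqP] e;
  [exists a|exists b|exists (a ^^ b)|exists a|exists b|exists (a ^^ b)]; tauto.
Qed.

Lemma filled_iff_residue (F : realType) S p n R C (g := 2 ^ p) (s := S %% g) :
  2 < p -> 0 < s <= 8 -> S = s ^^ g -> p.+1 < n ->
  is_label n S R -> is_label n S C -> off_long_diagonals S R C ->
  filled F n S R C <->
  exists x, (x = R \/ x = C \/ x = R ^^ C) /\ (x %% g = 0 \/ x %% g = s).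
Proof.
case: n => [//|m] p_gt2 s_le8 eS; rewrite ltnS => p_m [R_in RS] [C_in CS] [RC0 RCS].
have s_lt : s < g by rewrite ltn_mod expn_gt0.
have pow_gt0 : 0 < 2 ^ m by rewrite expn_gt0.
have [R_lt C_lt] : R < 2 ^ m /\ C < 2 ^ m by move: R_in C_in => /=; lia.
have S_lt : S < 2 ^ m.
  rewrite eS; apply: lxor_lt; last by rewrite ltn_exp2l.
  by apply: ltn_trans s_lt _; rewrite ltn_exp2l.
have S0 : S != 0 by apply/eqP => S0; move: s_le8; rewrite /s S0 mod0n.
have gen : generic S R C.
  apply/and5P; split; last (apply/andP; split); try by apply/eqP.
  - by rewrite -lt0n; lia.
  - by rewrite -lt0n; lia.
  - by rewrite -lxor_eq0; apply/eqP.
have m_gt1 : 1 < m by lia.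
rewrite filled_quad // {1}eS quad_skybox -?eS //; last by lia.
rewrite genericPn -lxor_mod.
split=> [[x [x_in x_val]]|[x [x_in x_val]]].
  by case: x_in x_val => [->|[->|->]]; [exists R|exists C|exists (R ^^ C)]; tauto.
exists (x %% g); split=> //.
by case: x_in => [->|[->|->]]; tauto.
Qed.

Theorem theorem14 (F : realType) (S N : nat)
    (S_gt8 : 8 < S) (S_not_pow2 : forall k : nat, S <> 2 ^ k)
    (S_range : 2 ^ (N - 2) < S < 2 ^ (N - 1))
    (S_one_high_bit : exists! p : nat, high_bit S p) :
  let g := 2 ^ (N - 2) in
  let s := S %% g in
  (forall R C : nat, is_label N S R -> is_label N S C ->
     off_long_diagonals S R C ->
     (filled F N S R C <->
      exists x : nat, (x = R \/ x = C \/ x = Nat.lxor R C) /\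
                      (x = g \/ x = s)))
  /\
  (forall n : nat, N <= n ->
   forall R C : nat, is_label n S R -> is_label n S C ->
     off_long_diagonals S R C ->
     (filled F n S R C <->
      exists x : nat, (x = R \/ x = C \/ x = Nat.lxor R C) /\
                      skybox_value n g s x)).
Proof.
move=> g s.
have N_gt2 : 2 < N.
  rewrite ltnNge; apply/negP => N_le.
  have : 2 ^ (N - 1) <= 2 ^ 1 by rewrite leq_exp2l //; lia.
  by lia.
have eN : (N - 1) = (N - 2).+1 by lia.
rewrite eN in S_range.
have [p_gt2 s_le8 eS] := single_high_bit S_gt8 S_not_pow2 S_range S_one_high_bit.
rewrite -/g -/s in s_le8 eS.
have s_lt : s < g by rewrite ltn_mod expn_gt0.
have eS' : S = s + g by rewrite addn_lxor.
have lt_half n x R C : is_label n S R -> is_label n S C ->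
    x = R \/ x = C \/ x = R ^^ C -> x < 2 ^ n.-1.
  have gt0 : 0 < 2 ^ n.-1 by rewrite expn_gt0.
  move=> [R_in _] [C_in _]; have [R_lt C_lt] : R < 2 ^ n.-1 /\ C < 2 ^ n.-1 by lia.
  by case=> [->|[->|->]] //; apply: lxor_lt.
have filledE n : N <= n -> forall R C, is_label n S R -> is_label n S C ->
    off_long_diagonals S R C -> filled F n S R C <->
    exists x, (x = R \/ x = C \/ x = R ^^ C) /\ (x %% g = 0 \/ x %% g = s).
  by move=> N_n R C *; apply: filled_iff_residue => //; lia.
have ex_iff R C (P Q : nat -> Prop) :
    (forall x, x = R \/ x = C \/ x = R ^^ C -> (P x <-> Q x)) ->
    (exists x, (x = R \/ x = C \/ x = R ^^ C) /\ P x) <->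
    (exists x, (x = R \/ x = C \/ x = R ^^ C) /\ Q x).
  by move=> PQ; split=> -[x [x_in]] /(PQ x x_in); exists x.
split=> [R C R_in C_in RC|n N_n R C R_in C_in RC]; rewrite filledE //;
  apply: ex_iff => x x_in.
- have := lt_half _ _ _ _ R_in C_in x_in.
  rewrite -subn1 eN expnS -/g => x_lt.
  have [x0 xS] : x <> 0 /\ x <> S.
    case: R_in C_in RC => R_in RS [C_in CS] [RC0 RCS].
    by case: x_in => [->|[->|->]]; split=> //; lia.
  have [x_g|g_x] := ltnP x g; first by rewrite modn_small //; lia.
  by rewrite -(subnK g_x) modnDr modn_small; lia.
have x_lt := lt_half _ _ _ _ R_in C_in x_in.
split=> [x_mod|[_ [k [->|->]]]]; first last.
- by right; rewrite modnMDl modn_small.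
- by left; rewrite modnMl.
split=> //; exists (x %/ g).
by case: x_mod => e; [left|right]; rewrite {1}(divn_eq x g) e ?addn0.
Qed.
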